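(* Let $c\in\mathbb{R}$ with $|c|<1$ and let $\pi_c=(c-x_3)\,\pi$ be the corresponding necklace Poisson structure on the unit sphere $S^2\subset\mathbb{R}^3$. Then $\pi_c$ does not admit smooth rescaling: there is no smooth vector field $X$ on $S^2$ such that $L_X\pi_c=\pi_c$.
   Context: Let $S^2=\{x_1^2+x_2^2+x_3^2=1\}\subset\mathbb{R}^3$. Let $\pi$ be the rotation-invariant nondegenerate Poisson bivector field on $S^2$ such that $-\pi$ is the restriction to $S^2$ of $x_1\,\partial_{x_2}\wedge\partial_{x_3}+x_2\,\partial_{x_3}\wedge\partial_{x_1}+x_3\,\partial_{x_1}\wedge\partial_{x_2}$. In the stereographic coordinate $w=x+iy=(x_1-ix_2)/(1+x_3)$ on $S^2\setminus\{(0,0,-1)\}$ one has $\pi=\frac14(1+x^2+y^2)^2\,\partial_x\wedge\partial_y$ and $x_3=\frac{1-x^2-y^2}{1+x^2+y^2}$. For $c\in\mathbb{R}$ put $\pi_c=(c-x_3)\pi$. For $|c|<1$, $\pi_c$ vanishes exactly on the circle $\{x_3=c\}$ and is called a necklace Poisson structure. A Poisson bivector field $\sigma$ is said to admit smooth rescaling if there is a smooth vector field $X$ with $L_X\sigma=\sigma$ (equivalently, the class of $\sigma$ in its own second Poisson cohomology vanishes). *)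

(* Defs.v *)
From HB Require Import structures.
From mathcomp Require Import all_boot all_order all_algebra.
From mathcomp Require Import all_classical all_reals all_analysis.
From mathcomp Require Import ring.

Set Implicit Arguments.
Unset Strict Implicit.
Unset Printing Implicit Defensive.

Import Order.TTheory GRing.Theory Num.Theory.
Import numFieldNormedType.Exports.

Local Open Scope classical_set_scope.
Local Open Scope ring_scope.

Section Sphere.
Context {R : realType}.

Local Notation R3 := 'rV[R]_3.

(* The coordinates x_1, x_2, x_3 of R^3 carry the indices 0, 1, 2. *)
Definition vec (i : 'I_3) : R3 := delta_mx 0 i.

Definition dot (u v : R3) : R := \sum_(i < 3) u 0 i * v 0 i.

(* The norm of the library on row vectors is the sup norm, so the Euclidean
   norm is spelled out. *)
Definition enorm (u : R3) : R := Num.sqrt (dot u u).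

Definition sphere : set R3 := [set p | dot p p = 1].

Fixpoint diff_times (n : nat) (U : set R3) (F : R3 -> R) : Prop :=
  match n with
  | 0 => True
  | m.+1 => (forall x, U x -> differentiable F x) /\
            (forall i : 'I_3, diff_times m U (fun x => 'D_(vec i) F x))
  end.

Definition smooth_on (U : set R3) (F : R3 -> R) : Prop :=
  forall n, diff_times n U F.

(* A function on the sphere is represented by a function on R^3 of which only
   the values on the sphere matter; it is smooth if it extends smoothly near
   each point of the sphere. *)
Definition smooth_sphere (f : R3 -> R) : Prop :=
  forall p, sphere p ->
    exists (U : set R3) (F : R3 -> R),
      [/\ open U, U p, smooth_on U F &
          forall q, U q -> sphere q -> f q = F q].

(* Vectors of T_p S^2 are the vectors of R^3 orthogonal to p. *)
Definition smooth_vector_field (X : R3 -> R3) : Prop :=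
  (forall p, sphere p -> dot p (X p) = 0) /\
  (forall i : 'I_3, smooth_sphere (fun p => X p 0 i)).

(* For v tangent to the sphere at p, this is df_p(v): the derivative of f
   along t |-> (p + t v) / |p + t v|, a curve on the sphere with velocity v
   at t = 0. *)
Definition sphere_deriv (f : R3 -> R) (p v : R3) : R :=
  'D_v (fun x => f ((enorm x)^-1 *: x)) p.

(* A bivector of R^3 is the skew matrix of its values on pairs (dx_i, dx_j). *)
Definition wedge (u v : R3) : 'M[R]_3 := u^T *m v - v^T *m u.

(* (L_X s)^{ij} = X(s^{ij}) - s^{kj} d_k X^i - s^{ik} d_k X^j, that is,
   (L_X s)(df, dg) = X(s(df, dg)) - s(d(X f), dg) - s(df, d(X g)) for
   f = x_i and g = x_j, whose differentials span each cotangent space of the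
   sphere.  The vectors (s^{kj})_k and (s^{ik})_k are tangent to the sphere
   when s is a bivector field on it. *)
Definition lie_derivative (X : R3 -> R3) (s : R3 -> 'M[R]_3) (p : R3) :
    'M[R]_3 :=
  \matrix_(i < 3, j < 3)
    (sphere_deriv (fun q => s q i j) p (X p)
     - sphere_deriv (fun q => X q 0 i) p (col j (s p))^T
     - sphere_deriv (fun q => X q 0 j) p (row i (s p))).

Definition admits_smooth_rescaling (s : R3 -> 'M[R]_3) : Prop :=
  exists X : R3 -> R3, smooth_vector_field X /\
    forall p, sphere p -> lie_derivative X s p = s p.

Definition sphere_poisson (p : R3) : 'M[R]_3 :=
  - (p 0 0 *: wedge (vec 1) (vec 2%:R)
     + p 0 1 *: wedge (vec 2%:R) (vec 0)
     + p 0 2%:R *: wedge (vec 0) (vec 1)).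

Definition necklace (c : R) (p : R3) : 'M[R]_3 :=
  (c - p 0 2%:R) *: sphere_poisson p.

Lemma necklace_skew (c : R) (p : R3) : (necklace c p)^T = - necklace c p.
Proof.
apply/matrixP => i j; rewrite /necklace /sphere_poisson /wedge !mxE.
rewrite !big_ord_recl !big_ord0 !mxE; ring.
Qed.

Lemma necklace_tangent (c : R) (p : R3) : p *m necklace c p = 0.
Proof.
rewrite /necklace -scalemxAr; apply/eqP; rewrite scaler_eq0; apply/orP; right.
apply/eqP/rowP => j; rewrite /sphere_poisson /wedge /vec !mxE.
rewrite !big_ord_recl !big_ord0 !mxE !big_ord_recl !big_ord0 !mxE.
have -> : lift ord0 (ord0 : 'I_2) = 1 :> 'I_3 by apply: val_inj.
have -> : lift ord0 (lift ord0 (ord0 : 'I_1)) = 2%:R :> 'I_3 by apply: val_inj.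
have -> : (ord0 : 'I_3) = 0 by apply: val_inj.
by case: j => [[|[|[|//]]] hj] /=; ring.
Qed.

End Sphere.

(* Main.v *)
(* Write [z = x_3], [h = c - z], and [a d/dtheta + u d/dz] for [X] in cylindrical
   coordinates.  Since the area form is [dtheta dz], [L_X (h pi) = h pi] reads
   [- u - h (da/dtheta + du/dz) = h].  On the zero circle [h = 0] this gives
   [u = 0], and the [z]-derivative of the equation gives [da/dtheta = - 1],
   which is impossible because [a] is periodic along the circle.

   In Euclidean coordinates [(1 - z^2) a] is the inner product of [X] with
   [rot3 p = (- x_2, x_1, 0)], and the transversal direction is that of the
   meridians. *)

Require Import Defs.
From HB Require Import structures.
From mathcomp Require Import all_boot all_order all_algebra.
From mathcomp Require Import all_classical all_reals all_analysis.
From mathcomp Require Import ring.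

Set Implicit Arguments.
Unset Strict Implicit.
Unset Printing Implicit Defensive.

Import Order.TTheory GRing.Theory Num.Theory.
Import numFieldNormedType.Exports.

Local Open Scope classical_set_scope.
Local Open Scope ring_scope.

(** * Curves in space, their velocities and the chain rule *)

Section Curves.
Context {R : realType}.
Local Notation R3 := 'rV[R]_3.

(** The velocity is prescribed coordinatewise, so that it is checked and used through scalar
    [is_derive] facts. *)
Definition has_velocity (g : R -> R3) (t : R) (v : R3) : Prop :=
  forall i, is_derive t 1 (fun s => g s 0 i) (v 0 i).

Lemma has_velocity_differentiable (g : R -> R3) t v :
  has_velocity g t v -> differentiable g t.
Proof.
move=> gv; apply/derivable1_diffP/derivable_mxP => i j.
by rewrite (ord1 i); case: (gv j).
Qed.

Lemma is_derive_along (F : R3 -> R) (g : R -> R3) t v :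
  differentiable F (g t) -> has_velocity g t v ->
  is_derive t 1 (F \o g) ('D_v F (g t)).
Proof.
move=> dF gv; have dg := has_velocity_differentiable gv.
apply: DeriveDef.
  exact/diff_derivable/differentiable_comp.
rewrite deriveE; last exact: differentiable_comp.
rewrite diff_comp //= [RHS]deriveE //; congr ('d F (g t) _); rewrite -deriveE //.
have /derivable1_diffP/derive_mx -> := dg.
by apply/rowP => i; rewrite mxE; case: (gv i).
Qed.

Lemma derive_coord (F : R3 -> R) p v : differentiable F p ->
  'D_v F p = \sum_(i < 3) v 0 i * 'D_(vec i) F p.
Proof.
move=> dF; rewrite deriveE // {1}[v]row_sum_delta linear_sum /=.
by apply: eq_bigr => i _; rewrite linearZ /= deriveE.
Qed.

(** * The inner product and radial curves on the sphere *)

Lemma dotvE (u v : R3) :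
  dot u v = u 0 0 * v 0 0 + u 0 1 * v 0 1 + u 0 2%:R * v 0 2%:R.
Proof.
rewrite /dot !big_ord_recl big_ord0 addr0 addrA.
by congr (_ + _ + _); congr (u _ _ * v _ _); apply: val_inj.
Qed.

Lemma dotDl (u v w : R3) : dot (u + v) w = dot u w + dot v w.
Proof. by rewrite !dotvE !mxE; ring. Qed.

Lemma dotZl a (u v : R3) : dot (a *: u) v = a * dot u v.
Proof. by rewrite !dotvE !mxE; ring. Qed.

Lemma dotC (u v : R3) : dot u v = dot v u.
Proof. by rewrite !dotvE; ring. Qed.

(** Both sides are limits of the same difference quotients. This turns [sphere_deriv] into a
    one-variable derivative along [radial]. *)
Lemma derive_line (f : R3 -> R) p v :
  'D_v f p = 'D_1 (fun h : R => f (h *: v + p)) 0.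
Proof.
rewrite /derive; set g1 := fun h => h^-1 *: _; set g2 := fun h => h^-1 *: _.
suff -> : g1 = g2 by [].
by apply/funext => h; rewrite /g1 /g2 /= addr0 scale0r add0r [_%:A]mulr1.
Qed.

(* The curve along which [sphere_deriv] differentiates. *)
Definition radial (p v : R3) (h : R) : R3 :=
  (enorm (h *: v + p))^-1 *: (h *: v + p).

Lemma dot_line (p v : R3) h : sphere p -> dot p v = 0 ->
  dot (h *: v + p) (h *: v + p) = 1 + h ^+ 2 * dot v v.
Proof.
rewrite /sphere /= => sp pv; rewrite !(dotDl, dotZl) ![dot _ (_ + _)]dotC.
by rewrite !(dotDl, dotZl) sp pv [dot v p]dotC pv; ring.
Qed.

Lemma dotvv_ge0 (v : R3) : 0 <= dot v v.
Proof. by rewrite dotvE -!expr2 !addr_ge0 ?sqr_ge0. Qed.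

Lemma dot_line_gt0 (p v : R3) h : sphere p -> dot p v = 0 ->
  0 < 1 + h ^+ 2 * dot v v.
Proof.
by move=> sp pv; rewrite ltr_pwDl // mulr_ge0 ?sqr_ge0 ?dotvv_ge0.
Qed.

Lemma radial_sphere (p v : R3) h : sphere p -> dot p v = 0 ->
  sphere (radial p v h).
Proof.
move=> sp pv; rewrite /sphere /radial /=.
have h0 := dot_line_gt0 h sp pv.
rewrite dotZl dotC dotZl /enorm dot_line // mulrA -expr2 exprVn.
by rewrite sqr_sqrtr ?ltW // mulVf ?gt_eqF.
Qed.

Lemma radial0 (p v : R3) : sphere p -> radial p v 0 = p.
Proof.
rewrite /sphere /radial /enorm /= scale0r add0r => ->.
by rewrite sqrtr1 invr1 scale1r.
Qed.

(** By orthogonality the normalising factor is the inverse square root of 1 + h^2 |v|^2, whose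
    derivative at h = 0 vanishes; only the velocity [v] of the straight line remains. *)
Lemma radial_velocity (p v : R3) : sphere p -> dot p v = 0 ->
  has_velocity (radial p v) 0 v.
Proof.
move=> sp pv i.
have dq : is_derive (0 : R) 1 (fun h : R => 1 + h ^+ 2 * dot v v) 0.
  apply: is_derive_eq; rewrite /GRing.scale /= ; ring.
have q0 : 1 + (0 : R) ^+ 2 * dot v v = 1 by ring.
have ds : is_derive (0 : R) 1
    (fun h : R => Num.sqrt (1 + h ^+ 2 * dot v v)) 0.
  (* The zero derivative is put in the form given by the chain rule: the derivative of the square
     root at 1, times 0. *)
  have -> : (0 : R) = (2 * Num.sqrt 1)^-1 * 0 by rewrite mulr0.
  apply: (@is_derive1_comp _ Num.sqrt); last by rewrite mulr0.
  by rewrite mulr0 q0; apply: is_derive1_sqrt.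
have di : is_derive (0 : R) 1
    (fun h : R => (Num.sqrt (1 + h ^+ 2 * dot v v))^-1) 0.
  apply: is_derive_eq.
    by apply: is_deriveV => //; rewrite q0 sqrtr1 oner_neq0.
  by rewrite /GRing.scale /= mulr0.
have dl : is_derive (0 : R) 1 (fun h : R => h * v 0 i + p 0 i) (v 0 i).
  by apply: is_derive_eq; rewrite /GRing.scale /=; ring.
rewrite (_ : (fun s => _) =
    (fun h : R => (Num.sqrt (1 + h ^+ 2 * dot v v))^-1) *
    (fun h : R => h * v 0 i + p 0 i)); last first.
  by apply/funext => h; rewrite /radial !mxE /enorm dot_line.
by apply: is_derive_eq; rewrite q0 sqrtr1 invr1 /GRing.scale /=; ring.
Qed.

(** * Tangential derivatives computed through local extensions *)

Lemma sphere_derivE (F f : R3 -> R) p v : differentiable F p ->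
  (\forall q \near p, sphere q -> f q = F q) -> sphere p -> dot p v = 0 ->
  sphere_deriv f p v = 'D_v F p.
Proof.
move=> dF fF sp pv; rewrite /sphere_deriv derive_line.
have gv := radial_velocity sp pv.
have g0 : radial p v 0 = p by exact: radial0.
have dFg : differentiable F (radial p v 0) by rewrite g0.
have dc := is_derive_along dFg gv.
rewrite -[in RHS]g0 -(@derive_val _ _ _ _ _ _ _ dc).
(* The radial curve stays on the sphere, so [f] and [F] agree along it for small [h]. *)
apply: near_eq_derive.
have cg := differentiable_continuous (has_velocity_differentiable gv).
rewrite -g0 in fF.
have cF := cg _ fF; near=> h.
have fFh : sphere (radial p v h) -> f (radial p v h) = F (radial p v h).
  by near: h.
exact/fFh/radial_sphere.
Unshelve. all: by end_near. Qed.

(** Two levels of [diff_times] give these properties, and they suffice to differentiate a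
    first-order equation for [X] once. *)
Lemma smooth_sphere_extension (f : R3 -> R) p : smooth_sphere f -> sphere p ->
  exists F : R3 -> R,
    [/\ \forall q \near p, differentiable F q,
        \forall q \near p, sphere q -> f q = F q &
        forall i, differentiable ('D_(vec i) F) p].
Proof.
move=> sf sp; have [U [F [oU Up sF fF]]] := sf p sp.
have [dF dDF] := sF 2%N.
exists F; split.
- by near=> q; apply: dF; near: q; exact: open_nbhs_nbhs.
- by near=> q; apply: fF; near: q; exact: open_nbhs_nbhs.
- by move=> i; have [+ _] := dDF i; apply.
Unshelve. all: by end_near. Qed.

(** [sphere_deriv] is defined by one particular curve; through a local extension it gives the
    derivative along every curve on the sphere with the same velocity. *)
Lemma is_derive_sphere (f : R3 -> R) (g : R -> R3) t v : smooth_sphere f ->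
  (forall s, sphere (g s)) -> has_velocity g t v -> dot (g t) v = 0 ->
  is_derive t 1 (f \o g) (sphere_deriv f (g t) v).
Proof.
move=> sf sg gv pv; have [F [dF fF _]] := smooth_sphere_extension sf (sg t).
rewrite (sphere_derivE (nbhs_singleton dF) fF (sg t) pv).
apply: near_eq_is_derive (is_derive_along (nbhs_singleton dF) gv).
have cF := differentiable_continuous (has_velocity_differentiable gv) fF.
near=> s; have fFs : sphere (g s) -> f (g s) = F (g s) by near: s.
by rewrite /= fFs.
Unshelve. all: by end_near. Qed.

Lemma sphere_deriv_lin (f : R3 -> R) p u v a b : smooth_sphere f -> sphere p ->
  dot p u = 0 -> dot p v = 0 ->
  sphere_deriv f p (a *: u + b *: v) =
  a * sphere_deriv f p u + b * sphere_deriv f p v.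
Proof.
move=> sf sp pu pv; have [F [dF fF _]] := smooth_sphere_extension sf sp.
have dFp := nbhs_singleton dF.
have puv : dot p (a *: u + b *: v) = 0.
  by rewrite dotC dotDl !dotZl ![dot _ p]dotC pu pv !mulr0 addr0.
rewrite !(sphere_derivE dFp fF sp) // !deriveE //.
by rewrite linearD !linearZ.
Qed.

(** Near [t] the function is the sum of the coordinates of [w] times the partial derivatives of an
    extension along [g]. Second-order smoothness of [f] enters here. *)
Lemma derivable_sphere_deriv (f : R3 -> R) (g w : R -> R3) t v :
  smooth_sphere f -> (forall s, sphere (g s)) -> has_velocity g t v ->
  (forall s, dot (g s) (w s) = 0) ->
  (forall i, derivable (fun s => w s 0 i) t 1) ->
  derivable (fun s => sphere_deriv f (g s) (w s)) t 1.
Proof.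
move=> sf sg gv gw dw; have [F [dF fF dDF]] := smooth_sphere_extension sf (sg t).
have cg := differentiable_continuous (has_velocity_differentiable gv).
have : derivable (\sum_(i < 3) ((fun s => w s 0 i) * ('D_(vec i) F \o g))) t 1.
  apply: derivable_sum => i; apply: derivableM => //.
  by have [] := is_derive_along (dDF i) gv.
apply: near_eq_derivable.
have cdF := cg _ dF; have cfF := cg _ (nbhs_interior fF); near=> s.
have dFs : differentiable F (g s) by near: s.
have fFs : \forall q \near g s, sphere q -> f q = F q by near: s.
rewrite (sphere_derivE dFs fFs (sg s) (gw s)) derive_coord //.
by rewrite fct_sumE; apply: eq_bigr.
Unshelve. all: by end_near. Qed.

End Curves.

(** * Rotation fields and the rescaling equation at a point *)

Section Necklace.
Context {R : realType}.
Local Notation R3 := 'rV[R]_3.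

Definition triple (a b c : R) : R3 := \row_k [:: a; b; c]`_k.

Lemma triple0 a b c : triple a b c 0 0 = a. Proof. by rewrite mxE. Qed.
Lemma triple1 a b c : triple a b c 0 1 = b. Proof. by rewrite mxE. Qed.
Lemma triple2 a b c : triple a b c 0 2%:R = c. Proof. by rewrite mxE. Qed.
Definition tripleE := (triple0, triple1, triple2).

Lemma ord3P (P : 'I_3 -> Prop) : P 0 -> P 1 -> P 2%:R -> forall i, P i.
Proof.
move=> P0 P1 P2 [[|[|[|//]]] hi]; [move: P0|move: P1|move: P2];
  by congr P; exact: val_inj.
Qed.

(** The three fields are the cross products of the basis vectors with [p]: the infinitesimal
    rotations about the axes, and up to sign the Hamiltonian fields of the coordinates for
    [sphere_poisson]. *)
Definition rot1 (p : R3) : R3 := triple 0 (- p 0 2%:R) (p 0 1).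
Definition rot2 (p : R3) : R3 := triple (p 0 2%:R) 0 (- p 0 0).
Definition rot3 (p : R3) : R3 := triple (- p 0 1) (p 0 0) 0.

Lemma dot_rot1 p : dot p (rot1 p) = 0.
Proof. by rewrite dotvE !tripleE; ring. Qed.
Lemma dot_rot2 p : dot p (rot2 p) = 0.
Proof. by rewrite dotvE !tripleE; ring. Qed.
Lemma dot_rot3 p : dot p (rot3 p) = 0.
Proof. by rewrite dotvE !tripleE; ring. Qed.

(** Each column of [sphere_poisson] is minus a rotation field, so the Lie derivative differentiates
    the coordinates of [X] along rotations only. *)
Lemma necklaceE c (p : R3) i j : necklace c p i j = - (c - p 0 2%:R) *
  (triple (rot1 p 0 i) (rot2 p 0 i) (rot3 p 0 i)) 0 j.
Proof.
rewrite /necklace /sphere_poisson /wedge /vec !mxE !big_ord1 !mxE.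
move: i j; apply: ord3P; apply: ord3P => /=; ring.
Qed.

Lemma is_derive_coord (p v : R3) i :
  is_derive p v (fun q : R3 => q 0 i) (v 0 i).
Proof.
have did : derivable (@idfun R3) p v by exact: derivable_id.
apply: DeriveDef; first by move/derivable_mxP : did => /(_ 0 i).
have := derive_id p v; rewrite (derive_mx did) => /rowP/(_ i).
by rewrite mxE.
Qed.

(* [L_X (necklace c) = necklace c], read on the pairs of coordinates (3, 1) and
   (3, 2) and contracted with the horizontal vector (x_2, - x_1). *)
Lemma rescaling_eq c (X : R3 -> R3) p : smooth_vector_field X -> sphere p ->
  lie_derivative X (necklace c) p = necklace c p ->
  let x := p 0 0 in let y := p 0 1 in let z := p 0 2%:R in
  let D i v := sphere_deriv (fun q => X q 0 i) p v in
  X p 0 2%:R * (1 - z ^+ 2 + (c - z) * z) +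
  (c - z) * (y * D 2%:R (rot1 p) - x * D 2%:R (rot2 p)
             + (x * D 1 (rot3 p) - y * D 0 (rot3 p))) =
  - (c - z) * (1 - z ^+ 2).
Proof.
move=> [tX sX] sp /matrixP LX x y z D.
have pX := tX p sp.
have scal i a v : dot p v = 0 -> D i (a *: v) = a * D i v.
  move=> pv; rewrite -[a *: v]addr0 -(scale0r v) /D sphere_deriv_lin //.
  by rewrite mul0r addr0.
(* The entries of [necklace] are polynomials on the whole space and serve as their own
   extensions. *)
have Ds (i j : 'I_3) (F : R3 -> R) dF : differentiable F p ->
    (forall q, necklace c q i j = F q) -> is_derive p (X p) F dF ->
    sphere_deriv (fun q => necklace c q i j) p (X p) = dF.
  move=> dFp sF [_ <-]; apply: sphere_derivE => //.
  by near=> q.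
have dc i : differentiable (fun q : R3 => q 0 i) p.
  exact: differentiable_coord.
have := LX 2%:R 1; rewrite [LHS]mxE; have := LX 2%:R 0; rewrite [LHS]mxE.
have -> : (col 0 (necklace c p))^T = (- (c - z)) *: rot1 p.
  by apply/rowP; apply: ord3P; rewrite 2![LHS]mxE necklaceE !mxE /= /z; ring.
have -> : (col 1 (necklace c p))^T = (- (c - z)) *: rot2 p.
  by apply/rowP; apply: ord3P; rewrite 2![LHS]mxE necklaceE !mxE /= /z; ring.
have -> : row 2%:R (necklace c p) = (c - z) *: rot3 p.
  by apply/rowP; apply: ord3P; rewrite [LHS]mxE necklaceE !mxE /= /z; ring.
rewrite -!/(D _ _) !scal ?dot_rot1 ?dot_rot2 ?dot_rot3 //.
have d0 := is_derive_coord p (X p) 0.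
have d1 := is_derive_coord p (X p) 1.
have d2 := is_derive_coord p (X p) 2%:R.
have -> : sphere_deriv (fun q => necklace c q 2%:R 0) p (X p) =
    X p 0 2%:R * y - (c - z) * X p 0 1.
  apply: (Ds _ _ (fun q => (q 0 2%:R - c) * q 0 1)).
  - by apply: differentiableM => //; apply: differentiableB.
  - by move=> q; rewrite necklaceE !tripleE; ring.
  - by apply: is_derive_eq; rewrite /GRing.scale /= /y /z; ring.
have -> : sphere_deriv (fun q => necklace c q 2%:R 1) p (X p) =
    - X p 0 2%:R * x + (c - z) * X p 0 0.
  apply: (Ds _ _ (fun q => (c - q 0 2%:R) * q 0 0)).
  - by apply: differentiableM => //; apply: differentiableB.
  - by move=> q; rewrite necklaceE !tripleE; ring.
  - by apply: is_derive_eq; rewrite /GRing.scale /= /x /z; ring.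
rewrite !necklaceE !tripleE -/x -/y -/z => e0 e1.
move: sp pX; rewrite /sphere /= !dotvE -/x -/y -/z => sp pX.
have zz : 1 - z ^+ 2 = x * x + y * y by rewrite -sp; ring.
(* The combination is [y] times [e0] minus [x] times [e1]. The added zero stands for the inner
   product of [p] and [X p], which trades the horizontal components of [X] for the term in [z]. *)
transitivity (y * (- (c - z) * y) - x * (- (c - z) * - x) + (c - z) * 0);
  last by rewrite zz; ring.
by rewrite zz -e0 -e1 -pX; ring.
Unshelve. all: by end_near. Qed.

(** * Spherical coordinates: longitude [th], and angle [ph] from the pole where x_3 = 1 *)

Definition spherical (th ph : R) : R3 :=
  triple (sin ph * cos th) (sin ph * sin th) (cos ph).

Lemma spherical_sphere th ph : sphere (spherical th ph).
Proof.
rewrite /sphere /= dotvE !tripleE.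
transitivity (sin ph ^+ 2 * (cos th ^+ 2 + sin th ^+ 2) + cos ph ^+ 2).
  by ring.
by rewrite cos2Dsin2 mulr1 addrC cos2Dsin2.
Qed.

Lemma parallel_velocity th ph :
  has_velocity (spherical^~ ph) th (rot3 (spherical th ph)).
Proof.
apply: ord3P; rewrite !tripleE.
- rewrite (_ : (fun s => _) = (fun s => sin ph * cos s)); last first.
    by apply/funext => s; rewrite tripleE.
  by apply: is_derive_eq; rewrite /GRing.scale /=; ring.
- rewrite (_ : (fun s => _) = (fun s => sin ph * sin s)); last first.
    by apply/funext => s; rewrite tripleE.
  by apply: is_derive_eq; rewrite /GRing.scale /=; ring.
- rewrite (_ : (fun s => _) = cst (cos ph)); last first.
    by apply/funext => s; rewrite tripleE.
  exact: is_derive_cst.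
Qed.

Lemma meridian_velocity th ph : has_velocity (spherical th) ph
  (triple (cos ph * cos th) (cos ph * sin th) (- sin ph)).
Proof.
apply: ord3P; rewrite !tripleE.
- rewrite (_ : (fun s => _) = (fun s => sin s * cos th)); last first.
    by apply/funext => s; rewrite tripleE.
  by apply: is_derive_eq; rewrite /GRing.scale /=; ring.
- rewrite (_ : (fun s => _) = (fun s => sin s * sin th)); last first.
    by apply/funext => s; rewrite tripleE.
  by apply: is_derive_eq; rewrite /GRing.scale /=; ring.
- rewrite (_ : (fun s => _) = cos); last first.
    by apply/funext => s; rewrite tripleE.
  exact: is_derive_cos.
Qed.

(** * The rescaling equation to first order across the zero circle *)

Lemma acos_sin2 (c : R) : `|c| < 1 -> sin (acos c) ^+ 2 = 1 - c ^+ 2.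
Proof.
move=> c1; have {2}<- : cos (acos c) = c.
  by rewrite acosK // in_itv /= -ler_norml ltW.
by rewrite -(cos2Dsin2 (acos c)); ring.
Qed.

(** This sine is the radius of the zero circle, which stays away from the poles. *)
Lemma acos_sin_neq0 (c : R) : `|c| < 1 -> sin (acos c) != 0.
Proof.
move=> c1; rewrite -sqrf_eq0 acos_sin2 // gt_eqF //.
by rewrite subr_gt0 -real_normK ?num_real // expr_lt1.
Qed.

(** The shape of [K] in the proof of [rescaling_on_zero_circle], with abstract factors so that
    instance search finds the derivative. *)
Lemma derivable_meridian_comb (e1 e2 e3 e4 : R -> R) (a b t : R) :
  derivable e1 t 1 -> derivable e2 t 1 -> derivable e3 t 1 ->
  derivable e4 t 1 ->
  derivable (fun ph => (sin ph * a) * e1 ph - (sin ph * b) * e2 ph +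
    ((sin ph * b) * e3 ph - (sin ph * a) * e4 ph)) t 1.
Proof.
move=> /derivableP d1 /derivableP d2 /derivableP d3 /derivableP d4.
exact: ex_derive.
Qed.

(** At [acos c] the factor [c - cos ph] vanishes, which forces [u] to vanish there. In the
    derivative of the equation at that point, the derivative of [K] is multiplied by this same
    factor and drops out. *)
Lemma derive_divergence_eq (u K : R -> R) (c du : R) : `|c| < 1 ->
  is_derive (acos c) 1 u du -> derivable K (acos c) 1 ->
  (forall ph, u ph * (1 - cos ph ^+ 2 + (c - cos ph) * cos ph) +
    (c - cos ph) * (K ph + (1 - cos ph ^+ 2)) = 0) ->
  u (acos c) = 0 /\ sin (acos c) * du + K (acos c) = - (1 - c ^+ 2).
Proof.
move=> c1 dfu /derivableP dK eqn.
have ccos : cos (acos c) = c.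
  by rewrite acosK // in_itv /= -ler_norml ltW.
have ssin := acos_sin2 c1.
have s0 := acos_sin_neq0 c1.
have u0 : u (acos c) = 0.
  have /eqP := eqn (acos c); rewrite ccos subrr !mul0r !addr0 mulf_eq0.
  by rewrite -ssin sqrf_eq0 (negbTE s0) orbF => /eqP.
(* Differentiating the equation gives the claim multiplied by [sin (acos c)]. *)
split=> //; apply: (mulfI s0).
have : is_derive (acos c) 1 (fun ph : R =>
    u ph * (1 - cos ph ^+ 2 + (c - cos ph) * cos ph) +
    (c - cos ph) * (K ph + (1 - cos ph ^+ 2)))
    (sin (acos c) ^+ 2 * du
     + sin (acos c) * (K (acos c) + sin (acos c) ^+ 2)).
  apply: is_derive_eq; rewrite u0 ccos ssin /GRing.scale /=; ring.
rewrite (funext eqn) => -[_]; rewrite derive_cst ssin => e.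
transitivity (sin (acos c) ^+ 2 * du + sin (acos c) * (K (acos c)
  + (1 - c ^+ 2)) - sin (acos c) * (1 - c ^+ 2)); first by ring.
by rewrite ssin -e; ring.
Qed.

Lemma rescaling_on_zero_circle c (X : R3 -> R3) th : `|c| < 1 ->
  smooth_vector_field X ->
  (forall p, sphere p -> lie_derivative X (necklace c) p = necklace c p) ->
  let p := spherical th (acos c) in
  let D i v := sphere_deriv (fun q => X q 0 i) p v in
  X p 0 2%:R = 0 /\
  p 0 0 * D 1 (rot3 p) - p 0 1 * D 0 (rot3 p) = - (1 - c ^+ 2).
Proof.
move=> c1 sX LX p D.
have sp ph := spherical_sphere th ph.
have vp := meridian_velocity th (acos c).
set v := triple _ _ _ in vp.
pose E ph i w := sphere_deriv (fun q => X q 0 i) (spherical th ph) w.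
pose rt (r : R3 -> R3) ph := r (spherical th ph).
(* [K] collects the first-order terms of [rescaling_eq] as a function along the whole meridian, so
   that the equation can be differentiated across the circle. *)
pose K ph := (sin ph * sin th) * E ph 2%:R (rt rot1 ph) -
  (sin ph * cos th) * E ph 2%:R (rt rot2 ph) +
  ((sin ph * cos th) * E ph 1 (rt rot3 ph) -
   (sin ph * sin th) * E ph 0 (rt rot3 ph)).
pose u ph := X (spherical th ph) 0 2%:R.
have eqn ph : u ph * (1 - cos ph ^+ 2 + (c - cos ph) * cos ph) +
    (c - cos ph) * (K ph + (1 - cos ph ^+ 2)) = 0.
  have := rescaling_eq sX (sp ph) (LX _ (sp ph)).
  rewrite /= !tripleE -/(u ph) -![sphere_deriv _ _ _]/(E _ _ _) => e.
  transitivity (- (c - cos ph) * (1 - cos ph ^+ 2)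
                + (c - cos ph) * (1 - cos ph ^+ 2)); last by ring.
  by rewrite [(c - _) * (K ph + _)]mulrDr addrA; congr (_ + _); exact: e.
have du : is_derive (acos c) 1 u (D 2%:R v).
  apply: (is_derive_sphere (f := fun q => X q 0 2%:R)) => //.
    by case: sX.
  rewrite dotvE !tripleE.
  transitivity (sin (acos c) * cos (acos c) * (cos th ^+ 2 + sin th ^+ 2 - 1)).
    by ring.
  by rewrite cos2Dsin2 subrr mulr0.
have dE i (r : R3 -> R3) : (forall q, dot q (r q) = 0) ->
    (forall j, derivable (fun ph => rt r ph 0 j) (acos c) 1) ->
    derivable (fun ph => E ph i (rt r ph)) (acos c) 1.
  move=> qr dr.
  exact: (derivable_sphere_deriv (sX.2 i) sp vp (fun s => qr (spherical th s))).
have dsp j : derivable (fun ph => spherical th ph 0 j) (acos c) 1.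
  by case: (vp j).
have dneg j : derivable (fun ph => - spherical th ph 0 j) (acos c) 1.
  exact: derivableN.
have dr1 : forall j, derivable (fun ph => rt rot1 ph 0 j) (acos c) 1.
  apply: ord3P; rewrite /rt /rot1; under eq_fun do rewrite tripleE.
  - exact: derivable_cst.
  - exact: dneg.
  - exact: dsp.
have dr2 : forall j, derivable (fun ph => rt rot2 ph 0 j) (acos c) 1.
  apply: ord3P; rewrite /rt /rot2; under eq_fun do rewrite tripleE.
  - exact: dsp.
  - exact: derivable_cst.
  - exact: dneg.
have dr3 : forall j, derivable (fun ph => rt rot3 ph 0 j) (acos c) 1.
  apply: ord3P; rewrite /rt /rot3; under eq_fun do rewrite tripleE.
  - exact: dneg.
  - exact: dsp.
  - exact: derivable_cst.
have dK : derivable K (acos c) 1.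
  exact: (derivable_meridian_comb
    (dE 2%:R _ dot_rot1 dr1) (dE 2%:R _ dot_rot2 dr2)
    (dE 1 _ dot_rot3 dr3) (dE 0 _ dot_rot3 dr3)).
have [u0 e] := derive_divergence_eq c1 du dK eqn; split; first exact: u0.
(* The meridian derivative of the third component of [X] cancels the [rot1] and [rot2] terms of [K];
   only derivatives along the circle survive. *)
have ev : sin (acos c) * D 2%:R v =
    - (p 0 0 * - D 2%:R (rot2 p) + p 0 1 * D 2%:R (rot1 p)).
  have s0 := acos_sin_neq0 c1.
  have -> : v = (- sin th) *: rot1 p + cos th *: rot2 p.
    apply/rowP; apply: ord3P; rewrite !mxE /=; try ring.
    rewrite -[LHS]mulr1 -(cos2Dsin2 th); ring.
  have -> : D 2%:R (- sin th *: rot1 p + cos th *: rot2 p) =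
      - sin th * D 2%:R (rot1 p) + cos th * D 2%:R (rot2 p).
    exact: (sphere_deriv_lin _ _ (sX.2 _) (sp _) (dot_rot1 _) (dot_rot2 _)).
  have -> : p 0 0 = sin (acos c) * cos th by rewrite tripleE.
  have -> : p 0 1 = sin (acos c) * sin th by rewrite tripleE.
  by ring.
have eK : K (acos c) = p 0 1 * D 2%:R (rot1 p) - p 0 0 * D 2%:R (rot2 p) +
    (p 0 0 * D 1 (rot3 p) - p 0 1 * D 0 (rot3 p)).
  by rewrite [p 0 0]tripleE [p 0 1]tripleE.
by rewrite -e ev eK; ring.
Qed.

End Necklace.

(** * Periodicity along the zero circle *)

Theorem corollary3p3 (R : realType) (c : R) (hc : `|c| < 1) :
  ~ admits_smooth_rescaling (necklace c).
Proof.
move=> [X [sX LX]].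
pose g (th : R) := spherical th (acos c).
have sg th : sphere (g th) by exact: spherical_sphere.
(* The inner product of [X] with [rot3] along the circle. *)
pose A th := g th 0 0 * X (g th) 0 1 - g th 0 1 * X (g th) 0 0.
have dA (th : R) : is_derive th 1 A (- (1 - c ^+ 2)).
  have vg := parallel_velocity th (acos c).
  have dX i := is_derive_sphere (sX.2 i) sg vg (dot_rot3 _).
  have dX0 := dX 0; have dX1 := dX 1.
  have dg0 := vg 0; have dg1 := vg 1.
  have [u0 <-] := rescaling_on_zero_circle th hc sX LX.
  have pX := sX.1 _ (sg th).
  apply: is_derive_eq.
  move: pX; rewrite dotvE u0 mulr0 addr0 !tripleE /GRing.scale /= => pX.
  (* The product rule also differentiates the coordinates of [g]. Those terms add up to minus the
     horizontal part of the inner product of [g th] and [X], which is zero by tangency and [u0]. *)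
  transitivity (g th 0 0 * sphere_deriv (fun q => X q 0 1) (g th) (rot3 (g th))
      - g th 0 1 * sphere_deriv (fun q => X q 0 0) (g th) (rot3 (g th)) - 0).
    by rewrite -pX !tripleE -/(g th); ring.
  by rewrite subr0 !tripleE.
have pi0 : (0 : R) < pi *+ 2 by rewrite mulrn_wgt0 // pi_gt0.
(* [A] takes equal values at 0 and 2 pi, so its derivative vanishes somewhere; yet it is constantly
   minus the squared radius of the circle. *)
have [|||th _ [_ ]] := @Rolle R A 0 (pi *+ 2) pi0.
- by move=> th _; case: (dA th).
- by apply: derivable_within_continuous => th _; case: (dA th).
- by rewrite /A /g /spherical cos0 sin0 cos2pi sin2pi.
have [_ ->] := dA th.
move/eqP; rewrite oppr_eq0 -acos_sin2 // sqrf_eq0.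
by rewrite (negbTE (acos_sin_neq0 hc)).
Qed.
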